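(* Let $\mathcal R$ be a left-linear and left-value-free LCTRS and let $\Pi X.\,s\,[\exists\vec{x}.\varphi]$ be a satisfiable existentially constrained term. Then $\Pi X.\,s\,[\exists\vec{x}.\varphi]$ is a normal form with respect to $\to_{\mathcal R}$ if and only if for every $\rho\in\mathcal R$ and every position $p$ of $s$ there exists $u\in[\![\Pi X.\,s\,[\exists\vec{x}.\varphi]]\!]_{\mathsf v}$ such that there is no $v$ with $u\to^p_{[\![\rho]\!]}v$.
   Context: Terms are built over a sorted signature whose function symbols are split into theory symbols (whose argument and result sorts are theory sorts) and term symbols, and a set $\mathcal{V}$ of sorted variables; theory sorts and symbols are interpreted in a fixed model $\mathcal{M}$. Every element of the interpretation of each theory sort is a constant symbol, called a value; $\mathcal{V}al$ denotes the set of values. There is a theory sort of Booleans with standard interpretation and the usual connectives. A constraint is a Boolean-sorted term built from theory symbols and variables; a (possibly existentially quantified) formula is valid if it is true under all valuations of its free variables in $\mathcal{M}$ and satisfiable if true under some. $\mathcal{V}ar(\cdot)$ is the set of variables. A substitution $\sigma$ is a sort-preserving map from variables to terms with finite domain $\mathcal{D}om(\sigma)=\{x\mid \sigma(x)\neq x\}$; $\mathcal{V}Dom(\sigma)=\{x\mid\sigma(x)\in\mathcal{V}al\}$; $\sigma$ is $X$-valued if $\sigma(X)\subseteq\mathcal{V}al$. An existential constraint $\exists\vec{x}.\varphi$ is a sequence of variables $\vec x$ together with a constraint $\varphi$ with $\{\vec x\}\subseteq\mathcal{V}ar(\varphi)$; its free variables are $\mathcal{FV}ar(\exists\vec x.\varphi)=\mathcal{V}ar(\varphi)\setminus\{\vec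 x\}$. For a substitution $\sigma$, $\sigma\vDash_{\mathcal M}\exists\vec x.\varphi$ means $\sigma$ is $\mathcal{FV}ar(\exists\vec x.\varphi)$-valued and $(\exists\vec x.\varphi)\sigma$ is valid. An existentially constrained term $\Pi X.\,s\,[\exists\vec x.\varphi]$ consists of a set $X$ of variables, a term $s$ and an existential constraint with $\mathcal{FV}ar(\exists\vec x.\varphi)\subseteq X\subseteq\mathcal{V}ar(s)$ and $\{\vec x\}\cap\mathcal{V}ar(s)=\emptyset$; it is satisfiable if $\exists\vec x.\varphi$ is satisfiable. A constrained rewrite rule $\rho\colon \Pi Z.\,\ell\to r\,[\pi]$ consists of a set $Z$ of variables, terms $\ell,r$ of the same sort and a constraint $\pi$ with $\mathcal{V}ar(\pi)\cup(\mathcal{V}ar(r)\setminus\mathcal{V}ar(\ell))\subseteq Z$; it is left-linear if $\ell$ is linear and left-value-free if $\ell$ contains no values; $\mathcal{E}x\mathcal{V}ar(\rho)=\mathcal{V}ar(r)\setminus\mathcal{V}ar(\ell)$. Let $\Pi X.\,s\,[\exists\vec x.\varphi]$ be satisfiable, $\rho$ left-linear with $\mathcal{V}ar(\rho)\cap\mathcal{V}ar(s,\varphi)=\emptyset$, and $\{\vec z\}=\mathcal{V}ar(\pi)\setminus\mathcal{V}ar(\ell)$. The term has a $\rho$-redex at position $p$ of $s$ using $\gamma$ if (i) $\mathcal{D}om(\gamma)=\mathcal{V}ar(\ell)$, (ii) $s|_p=\ell\gamma$, (iii) $\gamma(x)\in\mathcal{V}al\cup X$ for all $x\in\mathcal{V}ar(\ell)\cap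 Z$, and (iv) $(\exists\vec x.\varphi)\Rightarrow(\exists\vec z.\pi\gamma)$ is valid; then, with $t=s[r\gamma]_p$, $\psi=\varphi\wedge\pi\gamma$, $\{\vec y\}=\mathcal{V}ar(\psi)\setminus\mathcal{V}ar(t)$, $Y=\mathcal{E}x\mathcal{V}ar(\rho)\cup(X\cap\mathcal{V}ar(t))$, there is a most general rewrite step $\Pi X.\,s\,[\exists\vec x.\varphi]\to^p_{\rho,\gamma}\Pi Y.\,t\,[\exists\vec y.\psi]$. One writes $\to_\rho$ if such a step exists for some position, some $\gamma$ and some renamed variant of $\rho$ whose variables are disjoint from those of the source term. An LCTRS $\mathcal R$ is a set of left-linear constrained rewrite rules (including the calculation rules for theory symbols); it is left-value-free if all its rules are; $\to_{\mathcal R}=\bigcup_{\rho\in\mathcal R}\to_\rho$; a constrained term is a normal form w.r.t. $\to_{\mathcal R}$ if it has no $\to_{\mathcal R}$-successor. For a set $R$ of pairs of ordinary terms, $u\to^p_R v$ means there are $\langle l,r'\rangle\in R$ and a substitution $\theta$ with $u|_p=l\theta$ and $v=u[r'\theta]_p$. Interpretation of a rule $\rho\colon\Pi Z.\,\ell\to r\,[\pi]$: $[\![\rho]\!]=\{\langle\ell\sigma,r\sigma\rangle\mid\mathcal{D}om(\sigma)=\mathcal{V}Dom(\sigma)=Z\cap\mathcal{V}ar(\ell,r),\ \sigma\vDash_{\mathcal M}\exists\vec z'.\pi\}$ where $\{\vec z'\}=\mathcal{V}ar(\pi)\setminus\mathcal{V}ar(\ell,r)$. Value interpretation: $[\![\Pi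 X.\,s\,[\exists\vec x.\varphi]]\!]_{\mathsf v}$ is the set of all terms $s\sigma$ where $\sigma$ is a substitution such that $\sigma(X)\subseteq\mathcal{V}al$, $\sigma(\mathcal{V}ar(s)\setminus X)\subseteq\mathcal V$, $\sigma(x)\neq\sigma(y)$ for distinct $x,y\in\mathcal{V}ar(s)\setminus X$, and $\sigma\vDash_{\mathcal M}\exists\vec x.\varphi$.
   Formalization: The variables in X (of the constrained term) and in Z (of the rules) are required to be of theory sorts; otherwise the value interpretation or the rule's interpretation can be empty and the equivalence fails. *)

(* Defs.v *)
From mathcomp Require Import all_boot.
From mathcomp Require Import boolp classical_sets functions cardinality.

Set Implicit Arguments.
Unset Strict Implicit.
Unset Printing Implicit Defensive.

Local Open Scope classical_set_scope.

(* A sorted signature, its variables and the fixed model of its theory part.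
   The carrier of a theory sort tau is { a : value | value_sort a = tau }, so
   the elements of the carriers are the values themselves.  [theory_sym] holds
   the theory symbols that are not values. *)
Record signature := Signature {
  sort : eqType;
  theory_sort : pred sort;
  bool_sort : sort;
  bool_sort_theory : theory_sort bool_sort;

  var : eqType;
  var_sort : var -> sort;
  var_infinite : forall tau, infinite_set [set x : var | var_sort x = tau];

  value : eqType;
  value_sort : value -> sort;
  value_sort_theory : forall a, theory_sort (value_sort a);
  carrier_nonempty :
    forall tau, theory_sort tau -> exists a, value_sort a = tau;

  theory_sym : eqType;
  theory_dom : theory_sym -> seq sort;
  theory_cod : theory_sym -> sort;
  theory_dom_theory : forall f, all theory_sort (theory_dom f);
  theory_cod_theory : forall f, theory_sort (theory_cod f);

  term_sym : eqType;
  term_dom : term_sym -> seq sort;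
  term_cod : term_sym -> sort;

  (* only meaningful on arguments of the sorts required by [theory_dom] *)
  theory_interp : theory_sym -> seq value -> value;
  theory_interp_sort : forall f args,
    map value_sort args = theory_dom f ->
    value_sort (theory_interp f args) = theory_cod f;

  bool_value : bool -> value;
  bool_value_inj : injective bool_value;
  bool_valueP :
    forall a, value_sort a = bool_sort <-> exists b, a = bool_value b;

  not_sym : theory_sym;
  not_symP :
    [/\ theory_dom not_sym = [:: bool_sort], theory_cod not_sym = bool_sort
      & forall a, theory_interp not_sym [:: bool_value a] = bool_value (~~ a)];
  and_sym : theory_sym;
  and_symP :
    [/\ theory_dom and_sym = [:: bool_sort; bool_sort],
        theory_cod and_sym = bool_sort
      & forall a b, theory_interp and_sym [:: bool_value a; bool_value b]
                    = bool_value (a && b)];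
  or_sym : theory_sym;
  or_symP :
    [/\ theory_dom or_sym = [:: bool_sort; bool_sort],
        theory_cod or_sym = bool_sort
      & forall a b, theory_interp or_sym [:: bool_value a; bool_value b]
                    = bool_value (a || b)];
  imp_sym : theory_sym;
  imp_symP :
    [/\ theory_dom imp_sym = [:: bool_sort; bool_sort],
        theory_cod imp_sym = bool_sort
      & forall a b, theory_interp imp_sym [:: bool_value a; bool_value b]
                    = bool_value (a ==> b)];
  iff_sym : theory_sym;
  iff_symP :
    [/\ theory_dom iff_sym = [:: bool_sort; bool_sort],
        theory_cod iff_sym = bool_sort
      & forall a b, theory_interp iff_sym [:: bool_value a; bool_value b]
                    = bool_value (a == b)];
  eq_sym : sort -> theory_sym;
  eq_symP : forall tau, theory_sort tau ->
    [/\ theory_dom (eq_sym tau) = [:: tau; tau],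
        theory_cod (eq_sym tau) = bool_sort
      & forall a b, value_sort a = tau -> value_sort b = tau ->
          theory_interp (eq_sym tau) [:: a; b] = bool_value (a == b)]
}.

Inductive symbol (S : signature) :=
| Value of value S
| Theory of theory_sym S
| Term of term_sym S.

Arguments Value {S}.
Arguments Theory {S}.
Arguments Term {S}.

Definition sym_dom (S : signature) (f : symbol S) : seq (sort S) :=
  match f with
  | Value _ => [::]
  | Theory g => theory_dom g
  | Term g => term_dom g
  end.

Definition sym_cod (S : signature) (f : symbol S) : sort S :=
  match f with
  | Value a => value_sort a
  | Theory g => theory_cod g
  | Term g => term_cod g
  end.

Definition is_value_sym (S : signature) (f : symbol S) : bool :=
  if f is Value _ then true else false.

Definition is_theory_sym (S : signature) (f : symbol S) : bool :=
  if f is Term _ then false else true.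

(* Raw terms; well-sortedness is the separate predicate [well_sorted]. *)
Inductive term (S : signature) :=
| Var of var S
| App of symbol S & seq (term S).

Arguments Var {S}.
Arguments App {S}.

Definition term_sort (S : signature) (t : term S) : sort S :=
  match t with
  | Var x => var_sort x
  | App f _ => sym_cod f
  end.

Fixpoint well_sorted (S : signature) (t : term S) : bool :=
  match t with
  | Var _ => true
  | App f ts => (map (@term_sort S) ts == sym_dom f) && all (@well_sorted S) ts
  end.

Fixpoint all_symbols (S : signature) (P : pred (symbol S)) (t : term S) : bool :=
  match t with
  | Var _ => true
  | App f ts => P f && all (all_symbols P) ts
  end.

(* variable occurrences, from left to right, with repetitions *)
Fixpoint var_occs (S : signature) (t : term S) : seq (var S) :=
  match t with
  | Var x => [:: x]
  | App _ ts => flatten (map (@var_occs S) ts)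
  end.

Definition vars (S : signature) (t : term S) : set (var S) := [set` var_occs t].

Definition linear (S : signature) (t : term S) : bool := uniq (var_occs t).

Definition value_term (S : signature) (a : value S) : term S := App (Value a) [::].

Definition Val (S : signature) : set (term S) := range (@value_term S).

Definition value_free (S : signature) (t : term S) : bool :=
  all_symbols (fun f => ~~ is_value_sym f) t.

Fixpoint subterm (S : signature) (t : term S) (p : seq nat) : option (term S) :=
  match p with
  | [::] => Some t
  | i :: q =>
      if t is App _ ts then
        if onth ts i is Some t' then subterm t' q else None
      else None
  end.

Definition positions (S : signature) (t : term S) : set (seq nat) :=
  [set p | isSome (subterm t p)].

(* [replace t p u] is t[u]_p for p a position of t, and t otherwise. *)
Fixpoint replace (S : signature) (t : term S) (p : seq nat) (u : term S) : term S :=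
  match p with
  | [::] => u
  | i :: q =>
      if t is App f ts then
        if onth ts i is Some t' then App f (set_nth t' ts i (replace t' q u))
        else t
      else t
  end.

Definition Dom (S : signature) (sigma : var S -> term S) : set (var S) :=
  [set x | sigma x <> Var x].

Definition VDom (S : signature) (sigma : var S -> term S) : set (var S) :=
  [set x | Val (sigma x)].

Definition is_subst (S : signature) (sigma : var S -> term S) : Prop :=
  (forall x, well_sorted (sigma x) /\ term_sort (sigma x) = var_sort x)
  /\ finite_set (Dom sigma).

Fixpoint subst (S : signature) (sigma : var S -> term S) (t : term S) : term S :=
  match t with
  | Var x => sigma x
  | App f ts => App f (map (subst sigma) ts)
  end.

Definition valued (S : signature) (X : set (var S)) (sigma : var S -> term S) :=
  forall x, X x -> Val (sigma x).

(* Variables of non-theory sorts do not occur in constraints; what a valuation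
   does on them is irrelevant. *)
Definition valuation (S : signature) (v : var S -> value S) : Prop :=
  forall x, theory_sort (var_sort x) -> value_sort (v x) = var_sort x.

(* Term symbols, which do not occur in constraints, get an arbitrary value. *)
Fixpoint eval (S : signature) (v : var S -> value S) (t : term S) : value S :=
  match t with
  | Var x => v x
  | App f ts =>
      match f with
      | Value a => a
      | Theory g => theory_interp g (map (eval v) ts)
      | Term _ => bool_value S true
      end
  end.

Definition is_constraint (S : signature) (phi : term S) : Prop :=
  [/\ well_sorted phi, term_sort phi = bool_sort S
    & all_symbols (@is_theory_sym S) phi].

Definition and_term (S : signature) (phi psi : term S) : term S :=
  App (Theory (and_sym S)) [:: phi; psi].

Record exconstraint (S : signature) := Ex {
  bound : seq (var S);
  body : term S
}.

Arguments Ex {S}.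

Definition is_exconstraint (S : signature) (E : exconstraint S) : Prop :=
  is_constraint (body E) /\ [set` bound E] `<=` vars (body E).

Definition FVar (S : signature) (E : exconstraint S) : set (var S) :=
  vars (body E) `\` [set` bound E].

Definition ex_true (S : signature) (v : var S -> value S) (E : exconstraint S) :=
  exists w, [/\ valuation w,
                forall x, x \notin bound E -> w x = v x
              & eval w (body E) = bool_value S true].

Definition ex_valid (S : signature) (E : exconstraint S) : Prop :=
  forall v, valuation v -> ex_true v E.

Definition ex_satisfiable (S : signature) (E : exconstraint S) : Prop :=
  exists2 v, valuation v & ex_true v E.

Definition ex_implies (S : signature) (E F : exconstraint S) : Prop :=
  forall v, valuation v -> ex_true v E -> ex_true v F.

(* Bound variables are not renamed: this is used only when sigma maps the free
   variables to values, so that no capture can occur. *)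
Definition ex_subst (S : signature) (sigma : var S -> term S)
    (E : exconstraint S) : exconstraint S :=
  Ex (bound E)
     (subst (fun x => if x \in bound E then Var x else sigma x) (body E)).

Definition models (S : signature) (sigma : var S -> term S)
    (E : exconstraint S) : Prop :=
  valued (FVar E) sigma /\ ex_valid (ex_subst sigma E).

Record ecterm (S : signature) := ECTerm {
  ec_vars : set (var S);
  ec_term : term S;
  ec_constr : exconstraint S
}.

Arguments ECTerm {S}.

(* The variables in X are of theory sorts, as they stand for values. *)
Definition is_ecterm (S : signature) (C : ecterm S) : Prop :=
  [/\ well_sorted (ec_term C),
      is_exconstraint (ec_constr C),
      (forall x, ec_vars C x -> theory_sort (var_sort x)),
      FVar (ec_constr C) `<=` ec_vars C /\ ec_vars C `<=` vars (ec_term C)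
    & [set` bound (ec_constr C)] `&` vars (ec_term C) = set0].

Definition ec_satisfiable (S : signature) (C : ecterm S) : Prop :=
  ex_satisfiable (ec_constr C).

Record rule (S : signature) := Rule {
  rvars : set (var S);
  lhs : term S;
  rhs : term S;
  constr : term S
}.

Arguments Rule {S}.

Definition ExVar (S : signature) (rho : rule S) : set (var S) :=
  vars (rhs rho) `\` vars (lhs rho).

(* As for constrained terms, the variables in Z are of theory sorts. *)
Definition is_rule (S : signature) (rho : rule S) : Prop :=
  [/\ well_sorted (lhs rho) /\ well_sorted (rhs rho),
      term_sort (lhs rho) = term_sort (rhs rho),
      is_constraint (constr rho),
      (forall x, rvars rho x -> theory_sort (var_sort x))
    & vars (constr rho) `|` ExVar rho `<=` rvars rho].

Definition rule_vars (S : signature) (rho : rule S) : set (var S) :=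
  vars (lhs rho) `|` vars (rhs rho) `|` vars (constr rho).

Definition left_linear (S : signature) (rho : rule S) : bool :=
  linear (lhs rho).

Definition left_value_free (S : signature) (rho : rule S) : bool :=
  value_free (lhs rho).

Definition is_renaming (S : signature) (delta : var S -> var S) : Prop :=
  [/\ bijective delta,
      (forall x, var_sort (delta x) = var_sort x)
    & finite_set [set x | delta x <> x]].

Definition rename_rule (S : signature) (delta : var S -> var S) (rho : rule S) :
    rule S :=
  let s := subst (fun x => Var (delta x)) in
  Rule (delta @` rvars rho) (s (lhs rho)) (s (rhs rho)) (s (constr rho)).

Definition has_redex (S : signature) (C : ecterm S) (rho : rule S)
    (p : seq nat) (gamma : var S -> term S) : Prop :=
  [/\ Dom gamma = vars (lhs rho),
      subterm (ec_term C) p = Some (subst gamma (lhs rho)),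
      (forall x, (vars (lhs rho) `&` rvars rho) x ->
         Val (gamma x) \/ exists2 y, ec_vars C y & gamma x = Var y)
    & exists2 zs : seq (var S),
        [set` zs] = vars (constr rho) `\` vars (lhs rho)
        & ex_implies (ec_constr C) (Ex zs (subst gamma (constr rho)))].

Definition mg_step (S : signature) (rho : rule S) (p : seq nat)
    (gamma : var S -> term S) (C D : ecterm S) : Prop :=
  let t := replace (ec_term C) p (subst gamma (rhs rho)) in
  let psi := and_term (body (ec_constr C)) (subst gamma (constr rho)) in
  [/\ ec_satisfiable C /\ left_linear rho,
      rule_vars rho `&` (vars (ec_term C) `|` vars (body (ec_constr C))) = set0,
      is_subst gamma,
      has_redex C rho p gamma
    & exists2 ys : seq (var S),
        [set` ys] = vars psi `\` vars t
        & D = ECTerm (ExVar rho `|` (ec_vars C `&` vars t)) t (Ex ys psi)].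

Definition rule_step (S : signature) (rho : rule S) (C D : ecterm S) : Prop :=
  exists p gamma delta,
    is_renaming delta /\ mg_step (rename_rule delta rho) p gamma C D.

(* the rule f(x1,...,xn) -> y [y = f(x1,...,xn)] *)
Definition calculation_rule (S : signature) (f : theory_sym S)
    (xs : seq (var S)) (y : var S) : rule S :=
  let fx := App (Theory f) (map Var xs) in
  Rule [set` y :: xs] fx (Var y)
       (App (Theory (eq_sym (theory_cod f))) [:: Var y; fx]).

Definition has_calculation_rules (S : signature) (R : set (rule S)) : Prop :=
  forall f : theory_sym S, exists xs y,
    [/\ uniq (y :: xs), map (@var_sort S) xs = theory_dom f,
        var_sort y = theory_cod f & R (calculation_rule f xs y)].

Definition is_lctrs (S : signature) (R : set (rule S)) : Prop :=
  (forall rho, R rho -> is_rule rho /\ left_linear rho)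
  /\ has_calculation_rules R.

Definition lctrs_step (S : signature) (R : set (rule S)) (C D : ecterm S) : Prop :=
  exists2 rho, R rho & rule_step rho C D.

Definition normal_form (S : signature) (R : set (rule S)) (C : ecterm S) : Prop :=
  ~ exists D, lctrs_step R C D.

Definition pair_step (S : signature) (P : set (term S * term S)) (p : seq nat)
    (u v : term S) : Prop :=
  exists l r theta,
    [/\ P (l, r), is_subst theta, subterm u p = Some (subst theta l)
      & v = replace u p (subst theta r)].

Definition rule_interp (S : signature) (rho : rule S) : set (term S * term S) :=
  [set lr | exists sigma,
     [/\ is_subst sigma,
         Dom sigma = rvars rho `&` (vars (lhs rho) `|` vars (rhs rho)),
         VDom sigma = rvars rho `&` (vars (lhs rho) `|` vars (rhs rho)),
         exists2 zs : seq (var S),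
           [set` zs] = vars (constr rho) `\` (vars (lhs rho) `|` vars (rhs rho))
           & models sigma (Ex zs (constr rho))
       & lr = (subst sigma (lhs rho), subst sigma (rhs rho))]].

Definition value_interp (S : signature) (C : ecterm S) : set (term S) :=
  [set u | exists sigma,
     [/\ is_subst sigma /\ u = subst sigma (ec_term C),
         valued (ec_vars C) sigma,
         (forall x, (vars (ec_term C) `\` ec_vars C) x ->
            exists y, sigma x = Var y),
         (forall x y, (vars (ec_term C) `\` ec_vars C) x ->
            (vars (ec_term C) `\` ec_vars C) y -> x <> y -> sigma x <> sigma y)
       & models sigma (ec_constr C)]].

(* Main.v *)
(** A rewrite step of the constrained term at a position [p] instantiates to a
    step of every member of its value interpretation, because the validity of
    the constraint implication lets each model of the constraint be extended to
    the variables of the rule.  Conversely, assume that all members are reducible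
    at [p] by one rule.  A single member already determines the matching
    substitution: members differ from [s] only by values and variables at
    variable positions, while the left-hand side is linear and has no values.
    Since the match is the same for all members, their reducibility, one
    valuation at a time, is the required constraint implication. *)

Require Import Defs.
From mathcomp Require Import all_boot.
From Stdlib Require List.
From mathcomp Require Import boolp classical_sets functions cardinality.

Set Implicit Arguments.
Unset Strict Implicit.
Unset Printing Implicit Defensive.

Local Open Scope classical_set_scope.

(** Arguments are nested in a list, so the induction hypothesis has to be carried to them by an
    inner induction on that list. *)
Lemma nested_term_ind (S : signature) (P : term S -> Prop) :
  (forall x, P (Var x)) ->
  (forall f ts, List.Forall P ts -> P (App f ts)) -> forall t, P t.
Proof.
move=> PV PA; fix IH 1 => -[x|f ts]; first exact: PV.
apply: PA; elim: ts => [|t ts IHts]; first exact: List.Forall_nil.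
by apply: List.Forall_cons; [exact: IH | exact: IHts].
Qed.

(** * Substitution, evaluation and subterms *)

Section Terms.
Variable S : signature.
Implicit Types (t u l : term S) (s g : var S -> term S) (v w : var S -> value S).

Lemma subst_eq_in s1 s2 t :
  {in var_occs t, s1 =1 s2} -> subst s1 t = subst s2 t.
Proof.
elim/nested_term_ind: t => [x|f ts IH] /= eqs; first by apply: eqs; rewrite inE.
congr App; elim: IH eqs => //= t {}ts IHt _ IHts eqs.
by rewrite IHt ?IHts // => x xt; apply: eqs; rewrite mem_cat xt ?orbT.
Qed.

Lemma subst_inj_in s1 s2 t :
  subst s1 t = subst s2 t -> {in var_occs t, s1 =1 s2}.
Proof.
elim/nested_term_ind: t => [x|f ts IH] /=; first by move=> e y /[!inE] /eqP ->.
case; elim: IH => //= t {}ts IHt _ IHts [/IHt e1 /IHts e2] x.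
by rewrite mem_cat => /orP[/e1|/e2].
Qed.

Lemma subst_subst s1 s2 t :
  subst s1 (subst s2 t) = subst (fun x => subst s1 (s2 x)) t.
Proof.
elim/nested_term_ind: t => [//|f ts IH] /=; congr App.
by elim: IH => //= t {}ts -> _ ->.
Qed.

Lemma eval_subst v s t : eval v (subst s t) = eval (fun x => eval v (s x)) t.
Proof.
elim/nested_term_ind: t => [//|[a|f|f] ts IH] //=; congr theory_interp.
by elim: IH => //= t {}ts -> _ ->.
Qed.

Lemma eval_eq_in v w t : {in var_occs t, v =1 w} -> eval v t = eval w t.
Proof.
elim/nested_term_ind: t => [x|f ts IH] /= eqs; first by apply: eqs; rewrite inE.
case: f => // f; congr theory_interp; elim: IH eqs => //= t {}ts IHt _ IHts eqs.
by rewrite IHt ?IHts // => x xt; apply: eqs; rewrite mem_cat xt ?orbT.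
Qed.

Lemma term_sort_subst s t :
  (forall x, term_sort (s x) = var_sort x) ->
  term_sort (subst s t) = term_sort t.
Proof. by case: t => [x /(_ x)|]. Qed.

Lemma well_sorted_subst s t :
  (forall x, well_sorted (s x) /\ term_sort (s x) = var_sort x) ->
  well_sorted t -> well_sorted (subst s t).
Proof.
move=> sP; elim/nested_term_ind: t => [x _|f ts IH] /=; first by case: (sP x).
case/andP=> /eqP <- wts; apply/andP; split.
  apply/eqP; rewrite -map_comp; apply: eq_map => t /=.
  by apply: term_sort_subst => x; case: (sP x).
by elim: IH wts => //= t {}ts IHt _ IHts /andP[/IHt -> /IHts].
Qed.

Lemma well_sorted_subst_var s t :
  well_sorted (subst s t) -> {in var_occs t, forall x, well_sorted (s x)}.
Proof.
elim/nested_term_ind: t => [x|f ts IH] /=; first by move=> e y /[!inE] /eqP ->.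
case/andP=> _; elim: IH => //= t {}ts IHt _ IHts /andP[/IHt e1 /IHts e2] x.
by rewrite mem_cat => /orP[/e1|/e2].
Qed.

Lemma var_occs_subst s t x y :
  x \in var_occs t -> y \in var_occs (s x) -> y \in var_occs (subst s t).
Proof.
move=> xt ys; elim/nested_term_ind: t xt => [z|f ts IH] /=.
  by rewrite inE => /eqP <-.
elim: IH => //= t {}ts IHt _ IHts; rewrite !mem_cat.
by case/orP => [/IHt ->//|/IHts ->]; rewrite orbT.
Qed.

Lemma var_occs_rename (d : var S -> var S) t :
  var_occs (subst (fun x => Var (d x)) t) = map d (var_occs t).
Proof.
elim/nested_term_ind: t => [//|f ts IH] /=.
by elim: IH => //= t {}ts -> _ ->; rewrite map_cat.
Qed.

Lemma subterm_subst s t u p :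
  subterm t p = Some u -> subterm (subst s t) p = Some (subst s u).
Proof.
elim: p t => [|i p IH] [x|f ts] //=; [by case=> <-|by case=> <-|].
by rewrite onth_map; case: onth => //= t /IH.
Qed.

Lemma var_occs_subterm t u p :
  subterm t p = Some u -> {subset var_occs u <= var_occs t}.
Proof.
elim: p t => [|i p IH] [x|f ts] //=; [by case=> <-|by case=> <-|].
case E: onth => [t|] // /IH sub x /sub {sub}.
elim: ts i E => [|t' ts IHts] [|i] //=; first by case=> -> xt; rewrite mem_cat xt.
by move=> /IHts sub /sub; rewrite mem_cat orbC => ->.
Qed.

Lemma well_sorted_subterm t u p :
  subterm t p = Some u -> well_sorted t -> well_sorted u.
Proof.
elim: p t => [|i p IH] [x|f ts] //=; [by case=> <-|by case=> <-|].
case E: onth => [t|] // /IH sub /andP[_ wts]; apply: sub.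
elim: ts i E wts => [|t' ts IHts] [|i] //=; first by case=> -> /andP[].
by move=> /IHts sub /andP[_ /sub].
Qed.

(* Value-freeness of [l] keeps the non-variable positions of [l] away from the
   values that [s1] introduces; linearity lets the local matches be glued. *)
Lemma linear_value_free_match l t s1 s2 :
  linear l -> value_free l ->
  {in var_occs t, forall x, Val (s1 x) \/ exists y, s1 x = Var y} ->
  subst s1 t = subst s2 l -> exists g, t = subst g l.
Proof.
move=> + + s1P; move: t s1P; elim/nested_term_ind: l => [x|f ls IH] t s1P.
  by move=> _ _ _; exists (fun=> t).
rewrite /linear /value_free /= => lin /andP[nf vf].
case: t s1P => [x|f' ts] /= s1P.
  case: (s1P x); rewrite ?inE // => -[y]; last by move=> -> .
  by move=> _ <- [ef]; rewrite -ef in nf.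
case=> -> e; suff [g ->] : exists g, ts = map (subst g) ls by exists g.
elim: IH lin vf ts s1P e => [|l {}ls IHl _ IHls] /=.
  by move=> _ _ [] // _ _; exists Var.
rewrite cat_uniq => /and3P[lin dis lin'] /andP[vf vf'] [//|t ts] /= s1P [et ets].
have s1t : {in var_occs t, forall x, Val (s1 x) \/ exists y, s1 x = Var y}.
  by move=> x xt; apply: s1P; rewrite mem_cat xt.
have s1ts : {in flatten (map (@var_occs S) ts),
    forall x, Val (s1 x) \/ exists y, s1 x = Var y}.
  by move=> x xt; apply: s1P; rewrite mem_cat xt orbT.
have [g0 ->] := IHl t s1t lin vf et.
have [g1 ->] := IHls lin' vf' ts s1ts ets.
exists (fun x => if x \in var_occs l then g0 x else g1 x); congr cons.
  by apply: subst_eq_in => x ->.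
(* By linearity the variables of the remaining arguments do not occur in [l], so the glued
   substitution agrees with [g1] on them. *)
elim: ls dis {IHls lin' vf' ets} => //= u ls IHls.
rewrite has_cat negb_or => /andP[h /IHls ->].
congr cons; apply: subst_eq_in => x xu.
by rewrite ifN //; apply: contra h => xl; apply/hasP; exists x.
Qed.

(** * Finite supports and fresh renamings *)

Lemma is_subst_bounded s (xs : seq (var S)) :
  (forall x, well_sorted (s x) /\ term_sort (s x) = var_sort x) ->
  (forall x, x \notin xs -> s x = Var x) -> is_subst s.
Proof.
move=> sP sD; split=> //; apply: sub_finite_set (finite_seq xs) => x /= sx.
by apply: contra_notT sx => /sD.
Qed.

Lemma finite_diff_seq (xs : seq (var S)) (A : set (var S)) :
  exists zs : seq (var S), [set` zs] = [set` xs] `\` A.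
Proof.
have /finite_seqP[zs ->] : finite_set ([set` xs] `\` A); last by exists zs.
by apply: sub_finite_set (finite_seq xs) => x [].
Qed.

(** The renaming is a composition of transpositions, one per variable of [xs], each swapping the
    current image with a fresh variable of the same sort. *)
Lemma fresh_renaming (xs ys : seq (var S)) :
  exists2 d, is_renaming d & {in xs, forall x, d x \notin ys}.
Proof.
elim: xs => [|a xs [d [db ds df] dP]].
  exists id => //; split=> //; first by exists id.
  by apply: sub_finite_set (finite_set0 _) => x /=.
(* [y] must also avoid the images of [xs]: the swap would send such an image to [d a], which may lie
   in [ys]. *)
have [y [ya yN]] := infinite_setN0
  (infinite_setD (@var_infinite S (var_sort a)) (finite_seq (ys ++ map d xs))).
have {}yN : (y \notin ys) && (y \notin map d xs).
  by rewrite -negb_or -mem_cat; apply/negP.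
case/andP: yN => yNys yNd.
pose sw x := if x == d a then y else if x == y then d a else x.
have swK : involutive sw.
  move=> x; rewrite /sw; case: (eqVneq x (d a)) => [->|xa].
    by rewrite eqxx; case: eqVneq.
  case: (eqVneq x y) => [->|xy]; first by rewrite eqxx.
  by rewrite (negPf xa) (negPf xy).
exists (sw \o d); last first.
  move=> x /[!inE] /orP[/eqP->|xxs] /=; first by rewrite /sw eqxx.
  rewrite /sw; case: eqVneq => // _; case: eqVneq => [dy|_]; last exact: dP.
  by rewrite -dy map_f in yNd.
split.
- by apply: bij_comp => //; exists sw.
- move=> x /=; rewrite /sw; case: eqVneq => [e|_]; first by rewrite ya -(ds a) -e ds.
  by case: eqVneq => [e|_]; rewrite ds // -ya -e ds.
apply: (@sub_finite_set _ _ ([set x | d x <> x] `|` [set d a; y])); last first.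
  by rewrite finite_setU; split=> //; exact: finite_set2.
move=> x /= swx; have [e|] := eqVneq (d x) x; last by move=> /eqP ?; left.
right; move: swx; rewrite e /sw; case: eqVneq => [->|_]; first by left.
by case: eqVneq => [->|_]; [right|].
Qed.

(** * Valuations and substitutions by values *)

Lemma eval_Val v t : Val t -> t = value_term (eval v t).
Proof. by case=> a _ <-. Qed.

Lemma value_sort_eval v t :
  valuation v -> theory_sort (term_sort t) ->
  Val t \/ (exists y, t = Var y) -> value_sort (eval v t) = term_sort t.
Proof. by move=> vP ts [[a _ e]|[y e]]; subst t => //; exact: vP. Qed.

(** Once its free variables are replaced by values the constraint is closed, so truth under all
    valuations reduces to truth under the one that [s] encodes. *)
Lemma models_ex_true s v (E : exconstraint S) :
  valuation v -> (forall x, FVar E x -> s x = value_term (v x)) ->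
  models s E <-> ex_true v E.
Proof.
move=> vP sv; split.
  case=> _ /(_ v vP)[w [wP wv ew]]; exists w; split=> //.
  rewrite -ew /= eval_subst; apply: eval_eq_in => x xb /=.
  case: ifPn => //= xE; rewrite sv ?wv //.
  by split=> //; exact/negP.
case=> w [wP wv ew]; split; first by move=> x /sv ->; exists (v x).
move=> v0 v0P; exists (fun x => if x \in bound E then w x else v0 x); split.
- by move=> x; case: ifP => _; [exact: wP | exact: v0P].
- by move=> x /= /negPf ->.
rewrite -ew /= eval_subst; apply: eval_eq_in => x xb /=.
case: ifPn => xE /=; first by rewrite xE.
by rewrite sv /= ?wv //; split=> //; exact/negP.
Qed.

Lemma is_renaming_inverse (d : var S -> var S) :
  is_renaming d -> exists2 d', cancel d d' & cancel d' d.
Proof. by case=> -[d' dK d'K] _ _; exists d'. Qed.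

End Terms.

(** * Redexes of a constrained term and steps of its instances *)

Section Redexes.
Variable S : signature.
Implicit Types (C : ecterm S) (rho : rule S).

(** The instance [sg] yields a model of the constraint, and the redex condition extends it to the
    rule. The match is then split into values for the logical variables, which select the pair, and
    a substitution for the others. *)
Lemma redex_instance_step C rho (d : var S -> var S) p gamma u :
  is_ecterm C -> ec_satisfiable C -> is_rule rho -> is_renaming d ->
  rule_vars (rename_rule d rho) `&`
    (vars (ec_term C) `|` vars (body (ec_constr C))) = set0 ->
  is_subst gamma -> has_redex C (rename_rule d rho) p gamma ->
  value_interp C u -> exists v, pair_step (rule_interp rho) p u v.
Proof.
case: C => X s E [/= ws [_ _] Xth [FX Xs] _] [v0 v0P _].
case: rho => Z l r pi [/= [wl wr] _ [_ _ _] Zth piZ] [db ds _].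
move=> disj [gP _] [/= gD sp gX [zs zsE imp]] [sg [[[sgP sgf] ->] sgX _ _ sgE]].
have dI := bij_inj db.
have {gP}gP x : well_sorted (gamma (d x)) /\ term_sort (gamma (d x)) = var_sort x.
  by case: (gP (d x)); rewrite ds.
have dl x : (d x \in var_occs (subst (fun x => Var (d x)) l)) = (x \in var_occs l).
  by rewrite var_occs_rename mem_map.
rewrite subst_subst /= in sp.
have gl x : x \in var_occs l -> Z x ->
    Val (gamma (d x)) \/ exists2 y, X y & gamma (d x) = Var y.
  by move=> xl Zx; apply: gX; split; [rewrite /vars /= dl | exists x].
have gNl x : x \notin var_occs l -> gamma (d x) = Var (d x).
  move=> xl; apply: contrapT => gx; have : Dom gamma (d x) by [].
  by rewrite gD /vars /= dl (negPf xl).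
have gZ x : Z x -> Val (gamma (d x)) \/ exists y, gamma (d x) = Var y.
  move=> Zx; have [xl|/gNl gx] := boolP (x \in var_occs l); last by right; exists (d x).
  by case: (gl x xl Zx) => [|[y _ gx]]; [left | right; exists y].
(* Off [X] the satisfying valuation [v0] serves as a default of the right sort. *)
pose v x := if `[< X x >] then eval v0 (sg x) else v0 x.
have vX x : X x -> sg x = value_term (v x).
  by move=> Xx; rewrite /v asboolT //; apply: eval_Val; exact: sgX.
have vP : valuation v.
  move=> x xth; rewrite /v; case: asboolP => [Xx|_]; last exact: v0P.
  have [_ <-] := sgP x; apply: value_sort_eval => //; last by left; exact: sgX.
  by have [_ ->] := sgP x.
have /(imp _ vP) [w [wP wv ew]] : ex_true v E.
  by apply: (models_ex_true vP _).1 sgE => x /FX /vX.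
(* [w] may differ from [v] only on [zs], which consists of renamed rule variables, whereas [X] lies
   in the variables of [s]. *)
have wX y : X y -> w y = v y.
  move=> Xy; apply: wv => /=; apply/negP => yz.
  have : [set` zs] y by [].
  rewrite zsE => -[ypi _].
  suff : set0 y by [].
  by rewrite -disj; split; [right | left; exact: Xs].
have sgg x : x \in var_occs l -> Z x ->
    subst sg (gamma (d x)) = value_term (eval w (gamma (d x))).
  move=> xl /(gl x xl) [[a _ <-] //|[y Xy ->]] /=.
  by rewrite wX // vX.
(* [n] pulls [w] back along [d] and [gamma] to the original logical variables of the rule. *)
pose n x := if `[< Z x >] then eval w (gamma (d x)) else w x.
have nP : valuation n.
  move=> x xth; rewrite /n; case: asboolP => [Zx|_]; last exact: wP.
  have [_ <-] := gP x; apply: value_sort_eval => //; last exact: gZ.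
  by have [_ ->] := gP x.
pose D := Z `&` (vars l `|` vars r).
pose tau x := if `[< D x >] then value_term (n x) else Var x.
pose theta x := if (x \in var_occs l) && ~~ `[< Z x >]
  then subst sg (gamma (d x)) else Var x.
have [zs' zs'E] := finite_diff_seq (var_occs pi) (vars l `|` vars r).
exists (replace (subst sg s) p (subst theta (subst tau r))).
exists (subst tau l), (subst tau r), theta; split=> //; last 1 first.
- rewrite (subterm_subst _ sp) !subst_subst; congr Some.
  apply: subst_eq_in => x xl; rewrite /tau.
  case: asboolP => [[Zx _]|nD] /=; first by rewrite /n asboolT // sgg.
  by rewrite /theta xl asboolF // => Zx; apply: nD; split=> //; left.
- exists tau; split=> //=.
  + apply: (@is_subst_bounded _ _ (var_occs l ++ var_occs r)) => x.
      rewrite /tau; case: asboolP => //= -[Zx _]; split=> //.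
      by apply: nP; exact: Zth.
    rewrite mem_cat => xlr; rewrite /tau asboolF // => -[_ xlr'].
    by case/negP: xlr; apply/orP.
  + apply/seteqP; split=> x; rewrite /Dom /tau /=; first by case: asboolP.
    by move=> Dx; rewrite asboolT.
  + apply/seteqP; split=> x; rewrite /VDom /tau /=; first by case: asboolP => // _ [].
    by move=> Dx; rewrite asboolT //; exists (n x).
  + exists zs' => //.
    apply/(models_ex_true nP) => [x [/= xpi xzs]|].
      rewrite /tau asboolT //; split; first by apply: piZ; left.
      apply: contrapT => xlr; apply: xzs.
      by have : [set` zs'] x; [rewrite zs'E |].
    exists n; split=> //=; rewrite -ew subst_subst eval_subst.
    apply: eval_eq_in => x xpi; rewrite /n asboolT //.
    by apply: piZ; left.
- apply: (@is_subst_bounded _ _ (var_occs l)) => x; rewrite /theta; last first.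
    by case: ifP => // /andP[->].
  case: ifP => // _; have [wg <-] := gP x; split; first exact: well_sorted_subst.
  by apply: term_sort_subst => y; case: (sgP y).
Qed.

Lemma instances_step_redex C rho p :
  is_ecterm C -> ec_satisfiable C ->
  is_rule rho -> left_linear rho -> left_value_free rho ->
  positions (ec_term C) p ->
  (forall u, value_interp C u -> exists v, pair_step (rule_interp rho) p u v) ->
  exists D, rule_step rho C D.
Proof.
move=> CP Csat rhoP lin vf.
case: C CP Csat => X s E [/= ws [_ _] Xth [FX Xs] _] Csat.
case: rho rhoP lin vf => Z l r pi [/= [wl wr] _ [_ _ _] Zth piZ] lin vf.
rewrite /positions /=; case sp: subterm => [t|//] _ red.
(* These instances suffice for the argument: being the identity off [X], they keep the remaining
   variables distinct. *)
pose inst (v : var S -> value S) x := if `[< X x >] then value_term (v x) else Var x.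
have instP v : valuation v ->
    forall x, well_sorted (inst v x) /\ term_sort (inst v x) = var_sort x.
  move=> vP x; rewrite /inst; case: asboolP => //= Xx; split=> //.
  by apply: vP; exact: Xth.
have instVV v x : Val (inst v x) \/ exists y, inst v x = Var y.
  by rewrite /inst; case: asboolP => _; [left; exists (v x) | right; exists x].
have key v : valuation v -> ex_true v E -> exists tau theta zs,
    [/\ is_subst tau /\ is_subst theta,
        VDom tau = Z `&` (vars l `|` vars r),
        [set` zs] = vars pi `\` (vars l `|` vars r),
        models tau (Ex zs pi)
      & subst (inst v) t = subst theta (subst tau l)].
  move=> vP vE; have [|y] := red (subst (inst v) s).
    exists (inst v); split=> /=.
    - split=> //; apply: (@is_subst_bounded _ _ (var_occs s)); first exact: instP.
      by move=> x xs; rewrite /inst asboolF // => /Xs; rewrite /vars /= (negPf xs).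
    - by move=> x Xx; rewrite /inst asboolT //; exists (v x).
    - by move=> x [_ Xx]; exists x; rewrite /inst asboolF.
    - by move=> x y [_ Xx] [_ Xy] xy; rewrite /inst !asboolF // => -[].
    - by apply/(models_ex_true vP) => // x /FX Xx; rewrite /inst asboolT.
  case=> l' [r' [theta [[tau [tauP _ tauV [zs zsE tauE] [-> _]]] thetaP]]].
  rewrite (subterm_subst _ sp) => -[e] _.
  by exists tau, theta, zs; split.
have [v1 v1P v1E] := Csat.
have [tau1 [theta1 [zs1 [[tau1P theta1P] tau1V _ _ e1]]]] := key _ v1P v1E.
(* The instance at one model [v1] already fixes the match [g], which is kept for all other
   models. *)
have [g tg] : exists g, t = subst g l.
  apply: (linear_value_free_match lin vf _ (s1 := inst v1)
    (s2 := fun x => subst theta1 (tau1 x))) => [x _|]; first exact: instVV.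
  by rewrite e1 subst_subst.
rewrite {}tg in sp e1 key.
rewrite !subst_subst in e1; have {}e1 := subst_inj_in e1.
have gP x : x \in var_occs l ->
    well_sorted (g x) /\ term_sort (g x) = var_sort x.
  move=> xl; split.
    exact: (well_sorted_subst_var (well_sorted_subterm sp ws) xl).
  (* The sort of [g x] is read off its instance, which equals that of [tau1 x] under [theta1]. *)
  have <- : term_sort (subst (inst v1) (g x)) = term_sort (g x).
    by apply: term_sort_subst => y; case: (instP _ v1P y).
  rewrite e1 // term_sort_subst; first by case: tau1P => /(_ x)[].
  by move=> y; case: theta1P => /(_ y)[].
have gs x y : x \in var_occs l -> y \in var_occs (g x) -> y \in var_occs s.
  by move=> xl yg; apply: (var_occs_subterm sp); exact: var_occs_subst yg.
(* [tau1 x] is a value, and [inst v1] creates values only at variables of [X]. *)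
have gZ x : x \in var_occs l -> Z x ->
    Val (g x) \/ exists2 y, X y & g x = Var y.
  move=> xl Zx; have /(e1 x) := xl.
  have [a _ <-] : Val (tau1 x).
    by have : VDom tau1 x; [rewrite tau1V; split=> //; left|].
  case: (g x) => [y|f [|? ?]] //=; last by case=> ->; left; exists a.
  by rewrite /inst; case: asboolP => // Xy _; right; exists y.
have [d dP dfresh] := fresh_renaming (var_occs l ++ var_occs r ++ var_occs pi)
  (var_occs s ++ var_occs (body E)).
have [d' dK d'K] := is_renaming_inverse dP.
have [_ ds _] := dP; have dI := can_inj dK.
have d's y : var_sort (d' y) = var_sort y by rewrite -ds d'K.
(* [g] transported along the renaming, and cut down to the variables of the renamed left-hand
   side. *)
pose gamma y := if d' y \in var_occs l then g (d' y) else Var y.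
have gammad x : gamma (d x) = if x \in var_occs l then g x else Var (d x).
  by rewrite /gamma dK.
have dvars x u : vars (subst (fun x => Var (d x)) u) x <-> d' x \in var_occs u.
  by rewrite /vars /= var_occs_rename -{1}[x]d'K mem_map.
have [zs zsE] := finite_diff_seq
  (var_occs (subst (fun x => Var (d x)) pi)) (vars (subst (fun x => Var (d x)) l)).
have zsP y : (y \in zs) = (d' y \in var_occs pi) && (d' y \notin var_occs l).
  apply/idP/andP => [yz|[ypi yl]].
    have : [set` zs] y by [].
    by rewrite zsE => -[/dvars ypi /dvars/negP yl].
  suff : [set` zs] y by [].
  by rewrite zsE; split; [apply/dvars | apply/dvars/negP].
pose rho' := rename_rule d (Rule Z l r pi).
pose t' := replace s p (subst gamma (rhs rho')).
pose psi := and_term (body E) (subst gamma (constr rho')).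
have [ys ysE] := finite_diff_seq (var_occs psi) (vars t').
exists (ECTerm (ExVar rho' `|` (X `&` vars t')) t' (Ex ys psi)).
exists p, gamma, d; split=> //; split=> /=; last by exists ys.
- by split=> //; rewrite /left_linear /linear /= var_occs_rename map_inj_uniq.
- apply/seteqP; split=> // x [xrho xs].
  have /dfresh : d' x \in var_occs l ++ var_occs r ++ var_occs pi.
    by rewrite !mem_cat; case: xrho => [[]|] /dvars ->; rewrite ?orbT.
  by rewrite d'K mem_cat => /negP; apply; apply/orP.
- apply: (@is_subst_bounded _ _ (map d (var_occs l))) => y; rewrite /gamma.
    by case: ifP => // /gP; rewrite d's.
  by rewrite -{1}[y]d'K mem_map // => /negPf ->.
split=> /=.
- apply/seteqP; split=> y; rewrite /Dom /=.
    by rewrite /gamma; case: ifP => // yl _; apply/dvars.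
  (* A fixed point of [gamma] here would be a variable of [s], against the freshness of [d]. *)
  move/dvars => yl; rewrite /gamma yl => gy.
  have /dfresh/negP : d' y \in var_occs l ++ var_occs r ++ var_occs pi.
    by rewrite !mem_cat yl.
  apply; rewrite mem_cat d'K; apply/orP; left.
  by apply: (gs _ _ yl); rewrite gy inE.
- rewrite sp subst_subst; congr Some; apply: subst_eq_in => x xl /=.
  by rewrite gammad xl.
- move=> y [/dvars yl [x Zx xy]]; rewrite -xy dK in yl.
  by rewrite -xy gammad yl; exact: gZ.
exists zs => // v vP vE.
(* Reducibility of the instance at [v] gives a [tau] satisfying the rule constraint, and [e] ties it
   to the common match [g] on [l]. *)
have [tau [theta [zs0 [[[tauP _] _] tauV zs0E tauE e]]]] := key _ vP vE.
rewrite !subst_subst in e; have {}e := subst_inj_in e.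
have zs0P x : x \in zs0 -> x \notin var_occs l.
  move=> xz; have : [set` zs0] x by [].
  by rewrite zs0E => -[_ xlr]; apply/negP => xl; apply: xlr; left.
have tauFV x : FVar (Ex zs0 pi) x -> Val (tau x) by case: tauE => + _; exact.
(* [zs0] omits the constraint variables that occur in [r], while the redex condition quantifies over
   them: their witnesses come from [tau] through [n], those for [zs0] from [w]. *)
pose n x := if `[< FVar (Ex zs0 pi) x >] then eval v (tau x) else v x.
have nP : valuation n.
  move=> x xth; rewrite /n; case: asboolP => [/tauFV xF|_]; last exact: vP.
  have [_ <-] := tauP x; apply: value_sort_eval => //; last by left.
  by have [_ ->] := tauP x.
have [w [wP wn ew]] : ex_true n (Ex zs0 pi).
  apply: (models_ex_true nP _).1 tauE => x xF.
  by rewrite /n asboolT //; apply: eval_Val; exact: tauFV.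
exists (fun y => if y \in zs then w (d' y) else v y); split.
- move=> y yth; case: ifP => _; last exact: vP.
  by rewrite wP ?d's.
- by move=> y /= /negPf ->.
rewrite -ew /= subst_subst eval_subst; apply: eval_eq_in => x xpi /=.
rewrite gammad; case: ifPn => xl /=; last by rewrite zsP dK xpi xl.
have xz : x \notin zs0 by apply/negP => /zs0P; rewrite xl.
have xF : FVar (Ex zs0 pi) x by split=> //; exact/negP.
rewrite wn // /n asboolT //.
(* The variables of [g x] occur in [s], hence the witnesses chosen on [zs] do not affect its
   value. *)
transitivity (eval v (g x)).
  apply: eval_eq_in => y yg; rewrite zsP; case: ifP => // /andP[ypi _].
  have /dfresh/negP : d' y \in var_occs l ++ var_occs r ++ var_occs pi.
    by rewrite !mem_cat ypi !orbT.
  by case; rewrite d'K mem_cat (gs _ _ xl yg).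
(* [inst v] only replaces variables by their own values under [v], which makes the equation [e]
   applicable. *)
transitivity (eval v (subst (inst v) (g x))).
  rewrite eval_subst; apply: eval_eq_in => y _; rewrite /inst.
  by case: asboolP.
by rewrite e //; have [a _ <-] := tauFV x xF.
Qed.

End Redexes.

Theorem theorem6p7 (S : signature) (R : set (rule S)) (C : ecterm S)
    (R_lctrs : is_lctrs R)
    (R_left_linear : forall rho, R rho -> left_linear rho)
    (R_left_value_free : forall rho, R rho -> left_value_free rho)
    (C_ecterm : is_ecterm C)
    (C_satisfiable : ec_satisfiable C) :
  normal_form R C <->
  (forall (rho : rule S) (p : seq nat), R rho -> positions (ec_term C) p ->
     exists2 u, value_interp C u &
       ~ exists v, pair_step (rule_interp rho) p u v).
Proof.
have [R_rules _] := R_lctrs; split=> [nf rho p Rrho ps|irr [D [rho Rrho]]].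
  apply: contrapT => red; apply: nf.
  have [|D rhoD] := instances_step_redex C_ecterm C_satisfiable (R_rules _ Rrho).1
    (R_left_linear _ Rrho) (R_left_value_free _ Rrho) ps.
    by move=> u Cu; apply: contrapT => nou; apply: red; exists u.
  by exists D, rho.
case=> p [gamma [d [dP [_ disj gammaP redex _]]]].
have ps : positions (ec_term C) p.
  by case: redex => _ sp _ _; rewrite /positions /= sp.
have [u Cu] := irr rho p Rrho ps; apply.
exact: redex_instance_step (R_rules _ Rrho).1 dP disj gammaP redex Cu.
Qed.
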